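(* The exact (deterministic) classical complexity, measured in oracle queries, of the problem $DJ^{\otimes}$ on $n$-bit functions is $\Theta(n)$.
   Context: For $a,x\in\{0,1\}^n$, $a\cdot x=\sum_i a_ix_i \bmod 2$, and $\oplus$ is addition modulo 2. Let $F_{DJ}^{\otimes}$ be the set of all Boolean functions $f:\{0,1\}^n\to\{0,1\}$ of the form $f(x)=(a\cdot x)\oplus c$ with $a\in\{0,1\}^n$, $c\in\{0,1\}$. Each such function is either constant or balanced (balanced: takes value 1 on exactly half of its inputs). The problem $DJ^{\otimes}$: given oracle access to an unknown $f\in F_{DJ}^{\otimes}$, decide whether $f$ is constant or balanced. An exact classical algorithm is a deterministic adaptive query algorithm (decision tree): each query is a point $x\in\{0,1\}^n$, chosen depending on previous answers, and returns $f(x)$; the final output must be correct for every $f\in F_{DJ}^{\otimes}$. The complexity is the minimum over such algorithms of the worst-case (over $f\in F_{DJ}^{\otimes}$) number of queries, as a function of $n$. *)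

(* Defs.v *)
From mathcomp Require Import all_boot boolp.

Set Implicit Arguments.
Unset Strict Implicit.
Unset Printing Implicit Defensive.

Definition cube (n : nat) := {ffun 'I_n -> bool}.

Definition boolfun (n : nat) := {ffun cube n -> bool}.

Definition dotb n (a x : cube n) : bool := odd (\sum_(i < n) a i * x i).

Definition affine_fun n (a : cube n) (c : bool) : boolfun n :=
  [ffun x => dotb a x (+) c].

Definition DJ_tensor n : {set boolfun n} :=
  [set f | [exists a : cube n, exists c : bool, f == affine_fun a c]].

Definition is_constant n (f : boolfun n) : bool :=
  [forall x, forall y, f x == f y].

Definition is_balanced n (f : boolfun n) : bool :=
  2 * #|[set x | f x]| == #|{: cube n}|.

Inductive verdict := Constant | Balanced.

(* Nodes carry the queried point and one subtree per possible answer;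
   nothing forbids querying the same point twice on a path. *)
Inductive dtree (n : nat) :=
  | Output of verdict
  | Query of cube n & (bool -> dtree n).

Arguments Output {n}.

Fixpoint output n (t : dtree n) (f : boolfun n) : verdict :=
  match t with
  | Output v => v
  | Query x k => output (k (f x)) f
  end.

Fixpoint queries n (t : dtree n) (f : boolfun n) : nat :=
  match t with
  | Output _ => 0
  | Query x k => (queries (k (f x)) f).+1
  end.

Definition correct_on n (f : boolfun n) (v : verdict) : bool :=
  match v with
  | Constant => is_constant f
  | Balanced => is_balanced f
  end.

Definition solves_DJ n (t : dtree n) : Prop :=
  forall f, f \in DJ_tensor n -> correct_on f (output t f).

Definition worst_case n (t : dtree n) : nat :=
  \max_(f in DJ_tensor n) queries t f.

Lemma dotbE n (a x : cube n) : dotb a x = \big[addb/false]_(i < n) (a i && x i).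
Proof.
rewrite /dotb (big_morph odd oddD (erefl _)).
by apply: eq_bigr => i _; rewrite oddM !oddb.
Qed.

Lemma DJ_constant_or_balanced n (f : boolfun n) :
  f \in DJ_tensor n -> is_constant f \/ is_balanced f.
Proof.
rewrite inE => /existsP[a /existsP[c /eqP ->]].
have [/existsP[i ai]|/existsPn a0] := boolP [exists i, a i]; last first.
  left; apply/forallP => x; apply/forallP => y; rewrite !ffunE !dotbE.
  by rewrite !big1 // => i _; rewrite (negbTE (a0 i)).
right; pose g := affine_fun a c.
pose flip (x : cube n) : cube n := [ffun j => x j (+) (j == i)].
have flipK : involutive flip.
  by move=> x; apply/ffunP => j; rewrite !ffunE -addbA addbb addbF.
have gflip x : g (flip x) = ~~ g x.
  rewrite !ffunE !dotbE (bigD1 i) //= [in RHS](bigD1 i) //= ai ffunE eqxx addbT.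
  rewrite (eq_bigr (fun j => a j && x j)); last first.
    by move=> j /negbTE ji; rewrite ffunE ji addbF.
  by rewrite /= !addNb.
rewrite /is_balanced -(cardsC [set x | g x]).
have -> : ~: [set x | g x] = flip @: [set x | g x].
  apply/setP => x; rewrite !inE; apply/idP/imsetP => [gx|[y]].
    by exists (flip x); rewrite ?flipK// inE gflip.
  by rewrite inE => gy ->; rewrite gflip gy.
by rewrite (card_imset _ (inv_inj flipK)) mul2n addnn.
Qed.

Lemma solves_DJ_exists n : exists t : dtree n, solves_DJ t.
Proof.
pose upd (h : boolfun n) x b : boolfun n := [ffun y => if y == x then b else h y].
pose leaf (h : boolfun n) := if is_constant h then Constant else Balanced.
pose ask := fix ask (s : seq (cube n)) (h : boolfun n) : dtree n :=
  if s is x :: s' then Query x (fun b => ask s' (upd h x b)) else Output (leaf h).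
have askE (s : seq (cube n)) : forall h f : boolfun n,
    (forall x, x \notin s -> h x = f x) ->
    output (ask s h) f = leaf f.
  elim: s => [|x s IH] h f hf /=.
    by congr leaf; apply/ffunP => x; apply: hf.
  apply: IH => y ys; rewrite ffunE; case: eqP => [->//|/eqP yx].
  by apply: hf; rewrite inE negb_or yx.
exists (ask (enum {: cube n}) [ffun=> false]) => f fDJ.
rewrite askE => [|x]; last by rewrite mem_enum.
rewrite /leaf; case: ifP => //= fNc.
by case: (DJ_constant_or_balanced fDJ); rewrite ?fNc.
Qed.

Definition achievable n (d : nat) : bool :=
  `[< exists2 t : dtree n, solves_DJ t & worst_case t = d >].

Lemma achievable_exists n : exists d, achievable n d.
Proof.
have [t tP] := solves_DJ_exists n.
by exists (worst_case t); apply/asboolP; exists t.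
Qed.

Definition DJ_complexity (n : nat) : nat := ex_minn (achievable_exists n).

(* Main.v *)
(** For the lower bound, answer 0 to every query. If fewer than [n] points were
queried, then by the pigeonhole principle two distinct vectors of [{0,1}^n] have
the same dot product with each of them; their sum [a] is nonzero, and the
balanced function [a . x] cannot be told apart from the constant 0. For the
upper bound, querying 0 and the [n] unit vectors determines whether [a = 0]. *)
Require Import Defs.
From mathcomp Require Import all_boot all_order all_algebra.
From mathcomp Require Import all_classical all_reals topology normedtype landau.
Import numFieldNormedType.Exports.
Import Order.TTheory GRing.Theory Num.Theory.

Set Implicit Arguments.
Unset Strict Implicit.
Unset Printing Implicit Defensive.

Fixpoint queried n (t : dtree n) (f : boolfun n) : seq (cube n) :=
  if t is Query x k then x :: queried (k (f x)) f else [::].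

Lemma size_queried n (t : dtree n) (f : boolfun n) :
  size (queried t f) = queries t f.
Proof. by elim: t => //= x k IH; rewrite IH. Qed.

(** Adaptivity is harmless: [g] answers each query on the path of [f] exactly as [f] does, so it
    follows the same path to the same leaf. *)
Lemma eq_in_output n (t : dtree n) (f g : boolfun n) :
  {in queried t f, f =1 g} -> output t f = output t g.
Proof.
elim: t => //= x k IH fg; rewrite -(fg x) ?mem_head//.
by apply: IH => y yt; apply: fg; rewrite inE yt orbT.
Qed.

Definition unit_cube n (i : 'I_n) : cube n := [ffun j => j == i].

Lemma dotb_unit n (a : cube n) (i : 'I_n) : dotb a (unit_cube i) = a i.
Proof.
rewrite dotbE (bigD1 i) //= ffunE eqxx andbT big1 ?addbF// => j /negbTE ji.
by rewrite ffunE ji andbF.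
Qed.

Lemma dotb0r n (a : cube n) : dotb a [ffun=> false] = false.
Proof. by rewrite dotbE big1// => i _; rewrite ffunE andbF. Qed.

Lemma dotb0l n (x : cube n) : dotb [ffun=> false] x = false.
Proof. by rewrite dotbE big1// => i _; rewrite ffunE. Qed.

Lemma dotbDl n (a b x : cube n) :
  dotb [ffun i => a i (+) b i] x = dotb a x (+) dotb b x.
Proof.
rewrite !dotbE -big_split; apply: eq_bigr => i _.
by rewrite ffunE andb_addl.
Qed.

Lemma affine_fun_DJ n (a : cube n) (c : bool) : affine_fun a c \in DJ_tensor n.
Proof. by rewrite inE; apply/existsP; exists a; apply/existsP; exists c. Qed.

Lemma card_cube n : #|{: cube n}| = 2 ^ n.
Proof. by rewrite card_ffun card_bool card_ord. Qed.

Lemma dotb_orthogonal n (s : seq (cube n)) : size s < n ->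
  exists2 a : cube n, [exists i, a i] & {in s, forall x, dotb a x = false}.
Proof.
(* [h a] records the values of [dotb a] on [s]: there are [2 ^ n] vectors but only [2 ^ size s]
   possible records. *)
move=> sn; pose h (a : cube n) := [tuple of map (dotb a) (in_tuple s)].
have /injectivePn[a [b ab hab]] : ~~ injectiveb h.
  apply/injectiveP => /leq_card; rewrite card_cube card_tuple card_bool.
  by rewrite leq_exp2l// leqNgt sn.
exists [ffun i => a i (+) b i] => [|x xs].
  apply: contra_neqT ab => /existsPn ab0; apply/ffunP => i.
  by have := ab0 i; rewrite ffunE; case: (a i); case: (b i).
have /eq_in_map habE : map (dotb a) s = map (dotb b) s := congr1 val hab.
by rewrite dotbDl habE// addbb.
Qed.

Lemma worst_case_ge n (t : dtree n) : solves_DJ t -> n <= worst_case t.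
Proof.
move=> tP; pose f := affine_fun [ffun=> false] false : boolfun n.
have fE x : f x = false by rewrite ffunE dotb0l.
have fDJ : f \in DJ_tensor n by apply: affine_fun_DJ.
apply: leq_trans (leq_bigmax_cond _ fDJ).
(* The vector [a] is taken orthogonal to the points queried on the path of the zero function [f]. *)
rewrite leqNgt -size_queried; apply/negP => /dotb_orthogonal[a /existsP[i ai] a0].
pose g := affine_fun a false.
have fg : output t f = output t g.
  by apply: eq_in_output => x xt; rewrite fE ffunE a0.
have := tP g (affine_fun_DJ _ _); rewrite -fg.
(* The common verdict is wrong either way: [g] differs at 0 and at the [i]-th unit vector, while [f]
   never takes the value 1 on a nonempty cube. *)
have := tP f fDJ; case: (output t f) => /= [_ /forallP|fB _].
  move=> /(_ [ffun=> false])/forallP/(_ (unit_cube i)).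
  by rewrite !ffunE dotb0r dotb_unit ai.
move: fB; rewrite /is_balanced (_ : [set x | f x]%SET = finset.set0).
  by rewrite cards0 card_cube eq_sym expn_eq0.
by apply/setP => x; rewrite !inE fE.
Qed.

(** Here [c] stands for the value already found at 0; the first point with another value rules out
    constancy, so the search stops there. *)
Fixpoint probe n (c : bool) (s : seq (cube n)) : dtree n :=
  if s is x :: s' then
    Query x (fun b => if b == c then probe c s' else Output Balanced)
  else Output Constant.

Lemma queries_probe n (c : bool) (s : seq (cube n)) (f : boolfun n) :
  queries (probe c s) f <= size s.
Proof. by elim: s => //= x s IH; case: ifP. Qed.

Lemma output_probe n (c : bool) (s : seq (cube n)) (f : boolfun n) :
  output (probe c s) f = if all (fun x => f x == c) s then Constant else Balanced.
Proof. by elim: s => //= x s IH; case: ifP. Qed.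

Definition affine_tester n : dtree n :=
  Query [ffun=> false] (fun c => probe c [seq unit_cube i | i <- enum 'I_n]).

Lemma affine_tester_solves n : solves_DJ (affine_tester n).
Proof.
move=> f fDJ /=; rewrite output_probe; case: ifPn => [/allP f0|].
  move: fDJ f0; rewrite inE => /existsP[a /existsP[c /eqP ->]] f0.
  (* The value at 0 is [c] and the value at the [i]-th unit vector is [a i (+) c]; their equality
     forces [a i = false]. *)
  have a0 : a = [ffun=> false].
    apply/ffunP => i; have := f0 _ (map_f _ (mem_enum 'I_n i)).
    by rewrite !ffunE dotb0r dotb_unit; case: (a i); case: c {f0}.
  by apply/forallP => x; apply/forallP => y; rewrite !ffunE a0 !dotb0l.
case/allPn => x _ fx; have [/forallP/(_ x)/forallP fC|//] :=
  DJ_constant_or_balanced fDJ.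
by rewrite fC in fx.
Qed.

Lemma worst_case_affine_tester n : worst_case (affine_tester n) <= n.+1.
Proof.
apply/bigmax_leqP => f _ /=; rewrite ltnS (leq_trans (queries_probe _ _ _))//.
by rewrite size_map size_enum_ord.
Qed.

Lemma DJ_complexity_bounds n : n <= DJ_complexity n <= n.+1.
Proof.
rewrite /DJ_complexity; case: ex_minnP => d /asboolP[t tP <-] d_min.
rewrite worst_case_ge//=; apply: leq_trans (worst_case_affine_tester n).
by apply: d_min; apply/asboolP; exists (affine_tester n) => //;
  exact: affine_tester_solves.
Qed.

Local Open Scope ring_scope.
Local Open Scope classical_set_scope.

Theorem proposition2p5 (R : realType) :
  (fun n : nat => (DJ_complexity n)%:R : R) \is 'Theta_\oo (fun n : nat => n%:R : R).
Proof.
(* The upper constant 2 comes from [n + 1 <= 2 * n], valid once [n] is positive. *)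
apply/asboolP; exists (1, 2); first by rewrite /= ltr01 ltr0n.
near=> n; have n0 : (0 < n)%N by near: n; exact: nbhs_infty_gt.
have /andP[ge_n le_n1] := DJ_complexity_bounds n.
rewrite /= !normr_nat mul1r -natrM !ler_nat; split => //.
by rewrite (leq_trans le_n1)// mul2n -addnn -addn1 leq_add2l.
Unshelve. all: by end_near.
Qed.
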